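(* Let $\Gamma(i+\tfrac12)$ be an equal-area planar polygon, let $P\in\mathbb{R}^2$, and let $Z(i+\tfrac12)=\sum_{j=1}^{i}z(j)$, where $z(i)=[\Gamma(i+\tfrac12)-P,\Gamma'(i)]=[\Gamma(i-\tfrac12)-P,\Gamma'(i)]$ is the affine distance (support function) of $\Gamma$ with respect to $P$. Then the polygon $\Phi=(\Gamma,Z)$ in $\mathbb{R}^3$ has constant $\mu$. Conversely, any equal-volume polygon $\Phi$ in $\mathbb{R}^3$ with constant $\mu$ is obtained by this construction, for some planar polygonal line $\Gamma$ and some point $P\in\mathbb{R}^2$.
   Context: $[\cdot,\cdot]$ and $[\cdot,\cdot,\cdot]$ denote determinants of two vectors in $\mathbb{R}^2$ and of three vectors in $\mathbb{R}^3$. Polygons $\Gamma(i+\tfrac12)$ and $\Phi(i+\tfrac12)$ have vertices indexed by half-integers, and all indices range over the values for which the expressions are defined. Primes denote differences: $F'(i)=F(i+\tfrac12)-F(i-\tfrac12)$, $F''(i+\tfrac12)=F'(i+1)-F'(i)$, $F'''(i)=F''(i+\tfrac12)-F''(i-\tfrac12)$, $F''''(i+\tfrac12)=F'''(i+1)-F'''(i)$. A planar polygon $\Gamma$ is equal-area if $[\Gamma'(i),\Gamma'(i+1)]=1$ for all $i$. A polygon $\Phi$ in $\mathbb{R}^3$ is equal-volume if $[\Phi'(i-1),\Phi'(i),\Phi'(i+1)]=1$ for all $i$. For an equal-volume polygon $\Phi$, scalar functions $\rho_1,\rho_2,\tau$ are defined by $$\Phi''''(i+\tfrac12)=-\rho_2(i)\Phi''(i+\tfrac12)+\tau(i+\tfrac12)\Phi'(i+1),$$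 $$\Phi''''(i+\tfrac12)=-\rho_1(i+1)\Phi''(i+\tfrac12)+\tau(i+\tfrac12)\Phi'(i).$$ Taking any $\lambda$ with $\lambda(i)-\lambda(i+1)=\tau(i+\tfrac12)$, one defines $$\mu(i+\tfrac12)=\rho_1(i+1)-\lambda(i+1)=\rho_2(i)-\lambda(i).$$ ''Constant $\mu$'' means that $\mu(i+\tfrac12)$ does not depend on $i$.
   Formalization: The converse is proved up to an equi-affine change of coordinates of R^3 (a rotated or vertically translated Φ=(Γ,Z) is otherwise a counterexample) and for polygons with at least four vertices, since with fewer the equal-volume condition is void. *)

(* Defs.v *)
From mathcomp Require Import all_boot all_order all_algebra reals ring lra zify.
Set Implicit Arguments.
Unset Strict Implicit.
Unset Printing Implicit Defensive.
Import Order.TTheory GRing.Theory Num.Theory.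
Local Open Scope ring_scope.

(* A quantity indexed by half-integers, such as a polygon F(i+1/2) or a second
   difference F''(i+1/2), is a function on int whose value at i is the value at
   i+1/2; a quantity indexed by integers, such as F'(i), is a function on int
   in the plain sense.  The vertices of a polygon are the F(i+1/2) with i in an
   interval I of integers, bounded or not (so finite, one-sided infinite and
   bi-infinite polygons are covered); the values of F outside I are junk, and
   an expression at i is constrained only if it involves vertices in I only. *)

Section Differences.
Variable V : zmodType.
Implicit Types (F : int -> V) (i : int).

Definition diff1 F i := F i - F (i - 1).
Definition diff2 F i := diff1 F (i + 1) - diff1 F i.
Definition diff3 F i := diff2 F i - diff2 F (i - 1).
Definition diff4 F i := diff3 F (i + 1) - diff3 F i.

(* \sum_(j = 1)^i z j for i : int, with the usual convention
   - \sum_(j = i + 1)^0 z j when i < 0. *)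
Definition isum (z : int -> V) i : V :=
  match i with
  | Posz n => \sum_(1 <= j < n.+1) z j%:Z
  | Negz n => - \sum_(0 <= j < n.+1) z (- j%:Z)
  end.

Lemma isum0 z : isum z 0 = 0.
Proof. by rewrite /= big_geq. Qed.

Lemma diff1_isum z i : diff1 (isum z) i = z i.
Proof.
rewrite /diff1; case: i => [[|n]|n].
- by rewrite isum0 /= big_nat1 oppr0 opprK add0r.
- have -> : n.+1%:Z - 1 = n by lia.
  by rewrite /isum [X in X - _]big_nat_recr //= addrAC subrr add0r.
- have -> : Negz n - 1 = Negz n.+1 by lia.
  by rewrite /isum [X in - _ - - X]big_nat_recr //= opprK addKr NegzE.
Qed.

End Differences.

Section Polygons.
Variable R : realType.
Implicit Types (I : interval int) (i j : int).

Definition det2 (u v : 'rV[R]_2) : R := \det (col_mx u v : 'M_2).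
Definition det3 (u v w : 'rV[R]_3) : R :=
  \det (col_mx u (col_mx v w) : 'M_3).

Lemma det2E u v : det2 u v = u 0 0 * v 0 1 - u 0 1 * v 0 0.
Proof.
have E : (col_mx u v : 'M_2) = \matrix_(i, j) (if i == 0 then u 0 j else v 0 j).
  by apply/matrixP=> i j; rewrite !mxE; case: split_ordP => k ->; rewrite (ord1 k).
rewrite /det2 E (expand_det_row _ ord0) !big_ord_recl big_ord0.
rewrite /cofactor !det_mx11 !mxE /=.
have N (x : 'rV[R]_2) : x 0 =1 (fun n => x 0 (inord n)) \o val.
    by move=> k /=; rewrite inord_val.
move: (N u) (N v).
set u' := (fun n => u 0 (inord n)).
set v' := (fun n => v 0 (inord n)).
move=> Nu Nv; rewrite !Nu !Nv /= /bump /=; ring.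
Qed.

Lemma det3E u v w : det3 u v w =
  u 0 0 * (v 0 1 * w 0 2 - v 0 2 * w 0 1) -
  u 0 1 * (v 0 0 * w 0 2 - v 0 2 * w 0 0) +
  u 0 2 * (v 0 0 * w 0 1 - v 0 1 * w 0 0).
Proof.
have E : (col_mx u (col_mx v w) : 'M_3) = \matrix_(i, j)
    (if i == 0 then u 0 j else if i == 1 then v 0 j else w 0 j).
  apply/matrixP=> i j; rewrite !mxE.
  case: split_ordP => k -> //=; rewrite ?(ord1 k) // mxE.
  by case: split_ordP => l ->; rewrite (ord1 l).
rewrite /det3 E (expand_det_row _ ord0) !big_ord_recl big_ord0 /cofactor.
rewrite !(expand_det_row _ ord0) !big_ord_recl !big_ord0 /cofactor.
rewrite !det_mx11 !mxE /=.
have N (x : 'rV[R]_3) : x 0 =1 (fun n => x 0 (inord n)) \o val.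
    by move=> k /=; rewrite inord_val.
move: (N u) (N v) (N w).
set u' := (fun n => u 0 (inord n)).
set v' := (fun n => v 0 (inord n)).
set w' := (fun n => w 0 (inord n)).
move=> Nu Nv Nw; rewrite !Nu !Nv !Nw /= /bump /=; ring.
Qed.

Definition equal_area I (G : int -> 'rV[R]_2) : Prop :=
  forall i, i - 1 \in I -> i + 1 \in I ->
    det2 (diff1 G i) (diff1 G (i + 1)) = 1.

Definition equal_volume I (F : int -> 'rV[R]_3) : Prop :=
  forall i, i - 2 \in I -> i + 1 \in I ->
    det3 (diff1 F (i - 1)) (diff1 F i) (diff1 F (i + 1)) = 1.

(* diff4 F i involves exactly the vertices with index i - 2, ..., i + 2. *)
Definition inner I i : bool := (i - 2 \in I) && (i + 2 \in I).

Definition rho_tau_spec I (F : int -> 'rV[R]_3) (rho1 rho2 tau : int -> R) :=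
  forall i, inner I i ->
    diff4 F i = - rho2 i *: diff2 F i + tau i *: diff1 F (i + 1) /\
    diff4 F i = - rho1 (i + 1) *: diff2 F i + tau i *: diff1 F i.

Definition lambda_spec I (tau lambda : int -> R) :=
  forall i, inner I i -> lambda i - lambda (i + 1) = tau i.

Definition mu_spec I (rho1 rho2 lambda mu : int -> R) :=
  forall i, inner I i ->
    mu i = rho1 (i + 1) - lambda (i + 1) /\ mu i = rho2 i - lambda i.

Definition is_mu I (F : int -> 'rV[R]_3) (mu : int -> R) : Prop :=
  exists rho1 rho2 tau lambda : int -> R,
    [/\ rho_tau_spec I F rho1 rho2 tau, lambda_spec I tau lambda
      & mu_spec I rho1 rho2 lambda mu].

Definition constant_on I (mu : int -> R) : Prop :=
  forall i j, inner I i -> inner I j -> mu i = mu j.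

(* mu is only defined up to the choice of lambda, i.e. up to an additive
   constant.  For an equal-volume polygon the first conjunct always holds
   (is_mu_exists) and the second one may be checked on a single mu
   (constant_muP). *)
Definition constant_mu I (F : int -> 'rV[R]_3) : Prop :=
  (exists mu, is_mu I F mu) /\ (forall mu, is_mu I F mu -> constant_on I mu).

(* The support function; see also affine_distanceE. *)
Definition affine_distance (G : int -> 'rV[R]_2) (P : 'rV[R]_2) i : R :=
  det2 (G i - P) (diff1 G i).

Lemma affine_distanceE G P i :
  affine_distance G P i = det2 (G (i - 1) - P) (diff1 G i).
Proof. rewrite /affine_distance !det2E /diff1 !mxE; ring. Qed.

(* Lifts F satisfy F''' + kappa F' = (0, 0, 1) and F(1/2) has last coordinate 0,
   while equal-volume and constant mu are equi-affine notions: a general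
   equal-volume polygon with constant mu is a lift only in suitable equi-affine
   coordinates x |-> x A + b, det A = 1, of the space.  This also requires at
   least four vertices, otherwise equal_volume is void. *)
Definition lift_polygon (G : int -> 'rV[R]_2) (P : 'rV[R]_2) i : 'rV[R]_3 :=
  row_mx (G i) (isum (affine_distance G P) i)%:M.

Lemma itv_between I i j k : i \in I -> j \in I -> i <= k <= j -> k \in I.
Proof.
case: I => [l r]; rewrite !itv_boundlr => /andP[li _] /andP[_ jr] /andP[ik kj].
by rewrite (le_trans li) ?bnd_simp //= (le_trans _ jr) ?bnd_simp.
Qed.

Lemma det3_expand (x y z w : 'rV[R]_3) :
  det3 x y z = 1 -> det3 y z w = 1 ->
  w = x + det3 x w z *: y + det3 x y w *: z.
Proof.
rewrite !det3E => v1 v2; apply/rowP => k; rewrite !mxE.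
rewrite -[LHS]mul1r -[X in X + _ + _]mul1r -{1}v1 -{1}v2 {v1 v2}.
have [-> | [-> | ->]] : k = 0 \/ k = 1 \/ k = 2.
  case: k => [[|[|[|]]]] //= ?.
  - by left; apply: val_inj.
  - by right; left; apply: val_inj.
  - by right; right; apply: val_inj.
all: move: (x 0 0) (x 0 1) (x 0 2) (y 0 0) (y 0 1) (y 0 2) => x0 x1 x2 y0 y1 y2.
all: move: (z 0 0) (z 0 1) (z 0 2) (w 0 0) (w 0 1) (w 0 2) => z0 z1 z2 w0 w1 w2.
all: ring.
Qed.

Lemma rho_tau_exists I F : equal_volume I F ->
  exists rho1 rho2 tau, rho_tau_spec I F rho1 rho2 tau.
Proof.
move=> vF.
pose a i := diff1 F i.
pose al i := det3 (a (i - 1)) (a (i + 2)) (a (i + 1)).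
pose be i := det3 (a (i - 1)) (a i) (a (i + 2)).
exists (fun i => 3 - be (i - 1)), (fun i => al i + 3), (fun i => al i + be i).
move=> i /andP[Il Ir].
have v1 : det3 (a (i - 1)) (a i) (a (i + 1)) = 1.
  by apply: vF => //; apply: (itv_between Il Ir); clear; lia.
have v2 : det3 (a i) (a (i + 1)) (a (i + 2)) = 1.
  have E2 : i + 1 + 1 = i + 2 by rewrite -addrA.
  have := vF (i + 1); rewrite addrK E2.
  by apply=> //; apply: (itv_between Il Ir); clear; lia.
have D : a (i + 2) = a (i - 1) + al i *: a i + be i *: a (i + 1).
  exact: det3_expand.
have d4 : diff4 F i = a (i + 2) - a (i - 1) - 3 *: a (i + 1) + 3 *: a i.
  have E1 : i + 1 - 1 = i by rewrite addrK.
  have E2 : i + 1 + 1 = i + 2 by rewrite -addrA.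
  have E3 : i - 1 + 1 = i by rewrite subrK.
  rewrite /diff4 /diff3 /diff2 E1 E2 E3 -!/(a _) {D v1 v2}.
  move: (a (i + 2)) (a (i - 1)) (a i) (a (i + 1)) => x y z w.
  by apply/rowP=> k; rewrite !mxE; ring.
rewrite (addrK 1 i) d4 D /diff2 -!/(a _) {D d4 v1 v2}.
move: (al i) (be i) (a (i - 1)) (a i) (a (i + 1)) => x y u v w.
by split; apply/rowP=> k; rewrite !mxE; ring.
Qed.

Lemma equal_volume_free I F i (x y : R) :
  equal_volume I F -> inner I i ->
  x *: diff1 F i + y *: diff1 F (i + 1) = 0 -> x = 0 /\ y = 0.
Proof.
move=> vF /andP[Il Ir] E.
have Ir' : i + 1 \in I by apply: (itv_between Il Ir); clear; lia.
move: (vF i Il Ir').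
move: E; move: (diff1 F (i - 1)) (diff1 F i) (diff1 F (i + 1)) => u v w E.
have C k : x * v 0 k + y * w 0 k = 0.
  by have /matrixP/(_ 0 k) := E; rewrite !mxE.
rewrite det3E => D.
move: D (C 0) (C 1) (C 2); move: (v 0 0) (v 0 1) (v 0 2) (w 0 0) (w 0 1) (w 0 2).
move: (u 0 0) (u 0 1) (u 0 2) => u0 u1 u2 v0 v1 v2 w0 w1 w2 D c0 c1 c2.
split; rewrite -[LHS]mulr1 -{}D.
  transitivity (u0 * ((x * v1 + y * w1) * w2 - (x * v2 + y * w2) * w1) -
    u1 * ((x * v0 + y * w0) * w2 - (x * v2 + y * w2) * w0) +
    u2 * ((x * v0 + y * w0) * w1 - (x * v1 + y * w1) * w0)); first by ring.
  by rewrite c0 c1 c2; ring.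
transitivity (u0 * (v1 * (x * v2 + y * w2) - v2 * (x * v1 + y * w1)) -
    u1 * (v0 * (x * v2 + y * w2) - v2 * (x * v0 + y * w0)) +
    u2 * (v0 * (x * v1 + y * w1) - v1 * (x * v0 + y * w0))); first by ring.
by rewrite c0 c1 c2; ring.
Qed.

Lemma rho_tau_uniq I F r1 r2 t r1' r2' t' i : equal_volume I F ->
  rho_tau_spec I F r1 r2 t -> rho_tau_spec I F r1' r2' t' -> inner I i ->
  r2 i = r2' i /\ t i = t' i.
Proof.
move=> vF rt rt' ii; have [e _] := rt _ ii; have [e' _] := rt' _ ii.
have [] := equal_volume_free (x := r2 i - r2' i)
   (y := (t i - r2 i) - (t' i - r2' i)) vF ii.
  transitivity (diff4 F i - diff4 F i); last exact: subrr.
  by rewrite {1}e e' /diff2; apply/rowP=> k; rewrite !mxE; ring.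
by move=> ? ?; split; lra.
Qed.

Lemma rho1_rho2 I F r1 r2 t i : equal_volume I F ->
  rho_tau_spec I F r1 r2 t -> inner I i -> r1 (i + 1) = r2 i - t i.
Proof.
move=> vF rt ii; have [e e'] := rt _ ii.
have [] := equal_volume_free (x := r2 i - r1 (i + 1) - t i)
   (y := (t i - r2 i) + r1 (i + 1)) vF ii.
  transitivity (diff4 F i - diff4 F i); last exact: subrr.
  by rewrite {1}e e' /diff2; apply/rowP=> k; rewrite !mxE; ring.
by move=> ? ?; lra.
Qed.

Lemma lambda_exists I tau : exists lambda, lambda_spec I tau lambda.
Proof.
exists (fun i => - isum tau (i - 1)) => i _.
by rewrite (addrK 1 i) opprK addrC -[LHS]/(diff1 (isum tau) i) diff1_isum.
Qed.

Lemma is_mu_exists I F : equal_volume I F -> exists mu, is_mu I F mu.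
Proof.
move=> vF; have [rho1 [rho2 [tau rt]]] := rho_tau_exists vF.
have [lambda la] := lambda_exists I tau.
exists (fun i => rho2 i - lambda i), rho1, rho2, tau, lambda; split=> // i ii.
split=> //; rewrite (rho1_rho2 vF rt ii) -(la _ ii); ring.
Qed.

Lemma constant_muP I F mu :
  equal_volume I F -> is_mu I F mu -> constant_on I mu -> constant_mu I F.
Proof.
move=> vF mF cmu; split; first by exists mu.
move=> nu [r1' [r2' [t' [l' [rt' la' mu']]]]].
case: mF => [r1 [r2 [t [l [rt la mu_]]]]].
have [E2 Et] : (forall i, inner I i -> r2' i = r2 i) /\
               (forall i, inner I i -> t' i = t i).
  by split=> i ii; have [] := rho_tau_uniq vF rt' rt ii.
have step i : inner I i -> inner I (i + 1) -> nu (i + 1) = nu i.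
  move=> ii ii1; have := cmu _ _ ii ii1.
  rewrite (mu_ _ ii).2 (mu_ _ ii1).2 (mu' _ ii).2 (mu' _ ii1).2 !E2 //.
  by have := la _ ii; have := la' _ ii; rewrite Et //; lra.
have up n i : inner I i -> inner I (i + n%:Z) -> nu (i + n%:Z) = nu i.
  move=> ii; elim: n => [|n IHn] inn; first by rewrite addr0.
  have inn' : inner I (i + n%:Z).
    move: ii inn => /andP[a1 a2] /andP[b1 b2]; apply/andP; split.
      by apply: (itv_between a1 b2); clear; lia.
    by apply: (itv_between a1 b2); clear; lia.
  have -> : i + n.+1%:Z = i + n%:Z + 1 by clear; lia.
  rewrite step ?IHn //.
  by have <- : i + n.+1%:Z = i + n%:Z + 1 by clear; lia.
move=> i j ii ij; case: (leP i j) => [ij_le | /ltW ij_le].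
  have := up `|j - i|%N i ii; rewrite (_ : i + `|j - i|%N = j); last by clear -ij_le; lia.
  by move=> /(_ ij) ->.
have := up `|i - j|%N j ij; rewrite (_ : j + `|i - j|%N = i); last by clear -ij_le; lia.
by move=> /(_ ii) ->.
Qed.

End Polygons.

(* Main.v *)
Require Import Defs.
From mathcomp Require Import all_boot all_order all_algebra reals.
From mathcomp Require Import ring lra zify.
Set Implicit Arguments.
Unset Strict Implicit.
Unset Printing Implicit Defensive.
Import Order.TTheory GRing.Theory Num.Theory.
Local Open Scope ring_scope.

(** The theorem rests on one vector equation.  Call k an affine curvature of F
    with affine normal e when F''' + k F' = e for a fixed vector e.

    Differencing the equation gives F'''' = k(i) F'(i) - k(i+1) F'(i+1); read
    against the two defining expansions of F'''', this says rho_2(i) = k(i),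
    rho_1(i+1) = k(i+1), tau = k(i) - k(i+1), so that lambda = k is allowed
    and then mu = 0 ([affine_normal_is_mu]).  Conversely, if mu is a constant c,
    then F''' + k F' is a fixed vector for k = lambda + c
    ([constant_mu_affine_normal]).  Hence, for an equal-volume polygon with at
    least four vertices, constant mu means that some k has an affine normal.

    For an equal-area planar G one has G''' = - k G', because G'(i) is parallel
    to G'(i-1) + G'(i+1).  The support function z satisfies the inhomogeneous
    version z'' = - k z + 1 of the same recurrence ([diff2_affine_distance]),
    so the lift (G, Z), whose Z' is z, has the constant affine normal (0, 0, 1).

    For the converse, equal volume makes F'(i0-1), F'(i0), e a frame of
    determinant 1.  In the coordinates of this frame e becomes (0, 0, 1), and
    det3 (u, v, e) is the determinant of the planar parts, so the planar part G
    of F is equal-area with G''' = - k G'.  With P := G(i0-1), both the last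
    coordinate of F' and the support function of G vanish at i0-1 and at i0;
    they satisfy the same second-order recurrence, so they agree everywhere
    ([normal_frame_height]). *)

(** * Induction over a window of vertices *)

Section Intervals.
Variable I : interval int.
Implicit Types i j : int.

(** The set of i such that a polygon with vertex set I has all its vertices
    with index between i - a and i + b is again an interval; this is what
    allows to propagate a property step by step inside it. *)
Lemma itv_window_ind (a b : int) (Q : int -> Prop) i0 :
  i0 - a \in I -> i0 + b \in I -> Q i0 ->
  (forall i, i - a \in I -> i + b \in I ->
     i + 1 - a \in I -> i + 1 + b \in I -> Q i <-> Q (i + 1)) ->
  forall i, i - a \in I -> i + b \in I -> Q i.
Proof.
move=> a0 b0 Q0 step i ai bi.
have win j : (i0 <= j <= i) || (i <= j <= i0) -> j - a \in I /\ j + b \in I.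
  move=> Hj; split; case/orP: Hj => Hj.
  - by apply: (itv_between a0 ai); lia.
  - by apply: (itv_between ai a0); lia.
  - by apply: (itv_between b0 bi); lia.
  - by apply: (itv_between bi b0); lia.
case: (leP i0 i) => [le0i | /ltW lei0].
  have up n : i0 + n%:Z <= i -> Q (i0 + n%:Z).
    elim: n => [|n IHn] Hn; first by rewrite addr0.
    have E : i0 + n.+1%:Z = i0 + n%:Z + 1 by lia.
    have [w1 w2] := win (i0 + n%:Z) ltac:(lia).
    have [w3 w4] := win (i0 + n%:Z + 1) ltac:(lia).
    by rewrite E; apply/(step _ w1 w2 w3 w4)/IHn; lia.
  have -> : i = i0 + `|i - i0|%N%:Z by lia.
  by apply: up; lia.
have down n : i <= i0 - n%:Z -> Q (i0 - n%:Z).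
  elim: n => [|n IHn] Hn; first by rewrite subr0.
  have E : i0 - n%:Z = i0 - n.+1%:Z + 1 by lia.
  have [w1 w2] := win (i0 - n.+1%:Z) ltac:(lia).
  have [w3 w4] := win (i0 - n.+1%:Z + 1) ltac:(lia).
  by apply/(step _ w1 w2 w3 w4); rewrite -E; apply: IHn; lia.
have -> : i = i0 - `|i0 - i|%N%:Z by lia.
by apply: down; lia.
Qed.

End Intervals.

(** * Polygons with a constant affine normal *)

Section DifferenceRules.
Variable V : zmodType.
Implicit Types (F : int -> V) (i : int).

Lemma diff3E F i :
  diff3 F i = diff1 F (i + 1) - diff1 F i - (diff1 F i - diff1 F (i - 1)).
Proof. by rewrite /diff3 /diff2 subrK. Qed.

Lemma eq_diff1 F F' i : F =1 F' -> diff1 F i = diff1 F' i.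
Proof. by move=> E; rewrite /diff1 !E. Qed.

End DifferenceRules.

Section AffineNormal.
Variable R : realType.
Implicit Types (I : interval int) (F : int -> 'rV[R]_3) (k : int -> R).
Implicit Types (u v w e : 'rV[R]_3) (i : int).

Definition affine_normal I F k e : Prop :=
  forall i, i - 2 \in I -> i + 1 \in I -> diff3 F i + k i *: diff1 F i = e.

(** F'''' is the difference of -k F' at two consecutive indices; splitting off
    F'' in the two possible ways gives rho_2 and rho_1, with mu = k - k. *)
Lemma affine_normal_is_mu I F k e :
  affine_normal I F k e -> is_mu I F (fun=> 0).
Proof.
move=> nF; exists k, k, (fun i => k i - k (i + 1)), k; split=> // i ii; last first.
  by rewrite !subrr.
have [Il Ir] := andP ii.
have n0 : diff3 F i + k i *: diff1 F i = e.
  by apply: nF => //; apply: (itv_between Il Ir); lia.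
have n1 : diff3 F (i + 1) + k (i + 1) *: diff1 F (i + 1) = e.
  by apply: nF; apply: (itv_between Il Ir); lia.
have -> : diff4 F i = k i *: diff1 F i - k (i + 1) *: diff1 F (i + 1).
  rewrite /diff4 -[diff3 F i](addrK (k i *: diff1 F i)) n0 -n1.
  by apply/rowP=> j; rewrite !mxE; ring.
by split; apply/rowP=> j; rewrite /diff2 !mxE; ring.
Qed.

(** The same computation backwards: for k = lambda + mu, the definitions of rho_2
    and tau make F''' + k F' take equal values at consecutive indices. *)
Lemma constant_mu_affine_normal I F : (exists2 i, i - 2 \in I & i + 1 \in I) ->
  constant_mu I F -> exists k e, affine_normal I F k e.
Proof.
move=> [i0 I0l I0r] [[mu mF] /(_ _ mF) cmu].
case: mF => r1 [r2 [t [l [rt la mu_]]]].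
(* With exactly four vertices mu is defined nowhere, and any k will do. *)
have [c muc] : exists c, forall i, inner I i -> mu i = c.
  case: (boolP (inner I i0)) => [ii0 | nii0].
    by exists (mu i0) => i ii; apply: cmu.
  case: (boolP (inner I (i0 - 1))) => [ii0 | nii0'].
    by exists (mu (i0 - 1)) => i ii; apply: cmu.
  exists 0 => i /andP[il ir]; exfalso.
  have [ge|lt] := leP i0 i.
    move/negP: nii0; apply; apply/andP; split=> //.
    by apply: (itv_between I0r ir); lia.
  move/negP: nii0'; apply; apply/andP; split.
    by apply: (itv_between il I0l); lia.
  by apply: (itv_between I0l I0r); lia.
pose k i := l i + c; pose e i := diff3 F i + k i *: diff1 F i.
exists k, (e i0).
apply: (@itv_window_ind I 2 1 (fun i => e i = e i0) i0) => // i il _ _ ir.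
have ii : inner I i.
  by apply/andP; split=> //; rewrite (_ : i + 2 = i + 1 + 1) //; lia.
suff -> : e (i + 1) = e i by [].
have [E _] := rt _ ii; have [m1 m2] := mu_ _ ii; have la_ := la _ ii.
have r2E : r2 i = k i by rewrite /k -(muc _ ii) m2; ring.
have tE : t i = k i - k (i + 1) by rewrite -la_ /k; ring.
have -> : e (i + 1) = diff4 F i + diff3 F i + k (i + 1) *: diff1 F (i + 1).
  by rewrite /e /diff4 subrK.
by rewrite E r2E tE /e; apply/rowP=> j; rewrite /diff2 !mxE; ring.
Qed.

Lemma det3_mul u v w (A : 'M[R]_3) :
  det3 (u *m A) (v *m A) (w *m A) = det3 u v w * \det A.
Proof. by rewrite /det3 -det_mulmx !(mul_col_mx (m1 := 1)). Qed.

(** F'''(i) is F'(i-1) + F'(i+1) up to a multiple of F'(i), so next to F'(i) and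
    one of its two neighbours the affine normal may replace the other one. *)
Lemma det3_affine_normal F (c : R) i :
  det3 (diff1 F (i - 1)) (diff1 F i) (diff3 F i + c *: diff1 F i) =
  det3 (diff1 F (i - 1)) (diff1 F i) (diff1 F (i + 1)).
Proof. by rewrite diff3E !det3E !mxE; ring. Qed.

Lemma det3_affine_normal_next F (c : R) i :
  det3 (diff1 F i) (diff1 F (i + 1)) (diff3 F i + c *: diff1 F i) =
  det3 (diff1 F (i - 1)) (diff1 F i) (diff1 F (i + 1)).
Proof. by rewrite diff3E !det3E !mxE; ring. Qed.

Lemma diff1_mul F (A : 'M[R]_3) i :
  diff1 (fun j => F j *m A) i = diff1 F i *m A.
Proof. by rewrite /diff1 mulmxBl. Qed.

Lemma equal_volume_mul I F (A : 'M[R]_3) : \det A = 1 ->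
  equal_volume I F -> equal_volume I (fun j => F j *m A).
Proof. by move=> dA vF i Il Ir; rewrite !diff1_mul det3_mul dA mulr1 vF. Qed.

Lemma affine_normal_mul I F k e (A : 'M[R]_3) : affine_normal I F k e ->
  affine_normal I (fun j => F j *m A) k (e *m A).
Proof.
move=> nF i Il Ir; rewrite -(nF i) // [RHS]mulmxDl -scalemxAl diff1_mul.
by congr (_ + _); rewrite !diff3E !diff1_mul !(mulmxBl (_ - _)) !mulmxBl.
Qed.

(** Any three consecutive vertices lie in a window of four, but it may extend
    to either side, hence the two cases. *)
Lemma det3_edges_normal I F k e :
  (exists2 i, i - 2 \in I & i + 1 \in I) ->
  equal_volume I F -> affine_normal I F k e ->
  forall i, i - 1 \in I -> i + 1 \in I ->
    det3 (diff1 F i) (diff1 F (i + 1)) e = 1.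
Proof.
move=> [i0 I0l I0r] vF nF i Il Ir.
have [lt|ge] := leP i0 i.
  have Il' : i - 2 \in I by apply: (itv_between I0l Il); lia.
  by rewrite -(nF i) // det3_affine_normal_next; apply: vF.
have Il' : i + 1 - 2 \in I by apply: (itv_between Il Ir); lia.
have Ir' : i + 1 + 1 \in I by apply: (itv_between Ir I0r); lia.
by rewrite -(nF (i + 1)) // -{1}(addrK 1 i) det3_affine_normal; apply: vF.
Qed.

End AffineNormal.

(** * Planar part and height *)

Section Coordinates.
Variable R : realType.
Implicit Types (g : 'rV[R]_2) (a : R) (F : int -> 'rV[R]_3) (i : int).

Definition space g a : 'rV[R]_3 := row_mx g a%:M.
Definition planar (u : 'rV[R]_3) : 'rV[R]_2 := lsubmx (u : 'rV_(2 + 1)).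
Definition height (u : 'rV[R]_3) : R := u 0 2.

Lemma spaceE g a :
  [/\ space g a 0 0 = g 0 0, space g a 0 1 = g 0 1 & space g a 0 2 = a].
Proof.
rewrite /space; split.
- rewrite (_ : (0 : 'I_3) = lshift 1 (0 : 'I_2)); last exact: val_inj.
  exact: row_mxEl.
- rewrite (_ : (1 : 'I_3) = lshift 1 (1 : 'I_2)); last exact: val_inj.
  exact: row_mxEl.
- rewrite (_ : (2 : 'I_3) = rshift 2 (0 : 'I_1)); last exact: val_inj.
  by rewrite [LHS]row_mxEr mxE eqxx mulr1n.
Qed.

Lemma spaceK (u : 'rV[R]_3) : space (planar u) (height u) = u.
Proof.
rewrite /space; have -> : (height u)%:M = rsubmx (u : 'rV_(2 + 1)).
  rewrite [RHS]mx11_scalar mxE; congr (_%:M); rewrite /height.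
  by congr (u 0 _); apply: val_inj.
exact: (hsubmxK (u : 'rV_(2 + 1))).
Qed.

Lemma planar_space g a : planar (space g a) = g.
Proof. exact: row_mxKl. Qed.

Lemma height_space g a : height (space g a) = a.
Proof. by have [] := spaceE g a. Qed.

Lemma planarD (u v : 'rV[R]_3) : planar (u + v) = planar u + planar v.
Proof. by apply/rowP=> j; rewrite !mxE. Qed.

Lemma planarB (u v : 'rV[R]_3) : planar (u - v) = planar u - planar v.
Proof. by apply/rowP=> j; rewrite !mxE. Qed.

Lemma planarZ a (u : 'rV[R]_3) : planar (a *: u) = a *: planar u.
Proof. by apply/rowP=> j; rewrite !mxE. Qed.

Lemma heightD (u v : 'rV[R]_3) : height (u + v) = height u + height v.
Proof. by rewrite /height !mxE. Qed.

Lemma heightB (u v : 'rV[R]_3) : height (u - v) = height u - height v.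
Proof. by rewrite /height !mxE. Qed.

Lemma heightZ a (u : 'rV[R]_3) : height (a *: u) = a * height u.
Proof. by rewrite /height !mxE. Qed.

Lemma diff1_planar F i : diff1 (planar \o F) i = planar (diff1 F i).
Proof. by rewrite /diff1 planarB. Qed.

Lemma diff1_height F i :
  diff1 (height \o F : int -> R) i = height (diff1 F i).
Proof. by rewrite /diff1 heightB. Qed.

Lemma diff3_planar F i : diff3 (planar \o F) i = planar (diff3 F i).
Proof. by rewrite !diff3E !diff1_planar !planarB. Qed.

Lemma space_inj (u v : 'rV[R]_3) :
  planar u = planar v -> height u = height v -> u = v.
Proof. by move=> Ep Eh; rewrite -(spaceK u) -(spaceK v) Ep Eh. Qed.

Lemma det3_vertical (u v : 'rV[R]_3) :
  det3 u v (space 0 1) = det2 (planar u) (planar v).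
Proof.
rewrite -{1}(spaceK u) -{1}(spaceK v) det3E det2E.
have [-> -> ->] := spaceE (planar u) (height u).
have [-> -> ->] := spaceE (planar v) (height v).
by have [-> -> ->] := spaceE 0 1; rewrite !mxE; ring.
Qed.

(** For edges u, v and affine normal w, a frame given by the identity matrix
    provides the initial values of the recurrence for the heights and makes the
    affine normal vertical. *)
Lemma standard_frame (u v w : 'rV[R]_3) :
  (col_mx u (col_mx v w) : 'M_3) = 1%:M ->
  [/\ height u = 0, height v = 0 & w = space 0 1].
Proof.
move=> E.
have E0 j : u 0 j = (1%:M : 'M_3) 0 j.
  rewrite -E (_ : (0 : 'I_3) = lshift 2 (0 : 'I_1)); last exact: val_inj.
  by rewrite [RHS]col_mxEu.
have E1 j : v 0 j = (1%:M : 'M_3) 1 j.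
  rewrite -E (_ : (1 : 'I_3) = rshift 1 (lshift 1 (0 : 'I_1))); last exact: val_inj.
  by rewrite [RHS]col_mxEd [RHS]col_mxEu.
have E2 j : w 0 j = (1%:M : 'M_3) 2 j.
  rewrite -E (_ : (2 : 'I_3) = rshift 1 (rshift 1 (0 : 'I_1))); last exact: val_inj.
  by rewrite [RHS]col_mxEd [RHS]col_mxEd.
split; rewrite ?/height ?E0 ?E1 ?mxE //.
apply: space_inj; last by rewrite height_space /height E2 mxE.
apply/rowP=> j; rewrite planar_space !mxE E2 mxE.
by case: j => [[|[|]]].
Qed.

End Coordinates.

(** * Support functions and lifts *)

Section Lifts.
Variable R : realType.
Implicit Types (I : interval int) (G : int -> 'rV[R]_2) (P : 'rV[R]_2).

(** Discrete form of z'' = [G - P, G'''] + [G', G''].  Both neighbours of z(i)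
    can be expressed with the vertex G(i): z(i+1) = [G(i) - P, G'(i+1)] exactly,
    while z(i-1) = [G(i) - P, G'(i-1)] + [G'(i-1), G'(i)]. *)
Lemma diff2_affine_distance G P i :
  let z := affine_distance G P in
  z (i + 1) - z i - (z i - z (i - 1)) =
  det2 (G i - P) (diff3 G i) + det2 (diff1 G (i - 1)) (diff1 G i).
Proof.
rewrite /= (affine_distanceE G P (i + 1)) /affine_distance diff3E !det2E.
by rewrite /diff1 !mxE !addrK; ring.
Qed.

(** The curvature is read off by pairing with G'(i-1), as [G'(i-1), G'(i)] is
    1. *)
Lemma equal_area_diff3 I G : equal_area I G ->
  exists k, forall i, i - 2 \in I -> i + 1 \in I ->
    diff3 G i = - (k i : R) *: diff1 G i.
Proof.
move=> aG; exists (fun i => - det2 (diff1 G (i - 1)) (diff3 G i)) => i Il Ir.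
rewrite opprK diff3E.
have a1 : det2 (diff1 G (i - 1)) (diff1 G i) = 1.
  have := aG (i - 1); rewrite subrK; apply; apply: (itv_between Il Ir); lia.
have a2 : det2 (diff1 G i) (diff1 G (i + 1)) = 1.
  by apply: aG => //; apply: (itv_between Il Ir); lia.
move: a1 a2; rewrite !det2E.
move: (diff1 G (i - 1)) (diff1 G i) (diff1 G (i + 1)) => u v w a1 a2.
apply/rowP=> j; rewrite !mxE.
(* Cramer: [u, v] w + [v, w] u = [u, w] v.  The multiple - 2 v of [u, v]
   comes from [u, w - 2 v + u] = [u, w] - 2 [u, v]. *)
have := congr1 ( *%R (w 0 j - 2 * v 0 j)) a1; have := congr1 ( *%R (u 0 j)) a2.
have [-> | ->] : j = 0 \/ j = 1.
  case: j => [[|[|]]] //= ?; [left | right]; exact: val_inj.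
all: lra.
Qed.

Lemma diff1_lift G P i :
  diff1 (lift_polygon G P) i = space (diff1 G i) (affine_distance G P i).
Proof.
apply: space_inj.
  rewrite planar_space -diff1_planar.
  by apply: eq_diff1 => j; apply: planar_space.
rewrite height_space -diff1_height -(diff1_isum (affine_distance G P)).
by apply: eq_diff1 => j; apply: height_space.
Qed.

(** G''' + k G' = 0 and, by [diff2_affine_distance] with all areas 1,
    z'' + k z = 1. *)
Lemma lift_affine_normal I G P : equal_area I G ->
  exists k, affine_normal I (lift_polygon G P) k (space 0 1).
Proof.
move=> aG; have [k kG] := equal_area_diff3 aG; exists k => i Il Ir.
have a1 : det2 (diff1 G (i - 1)) (diff1 G i) = 1.
  have := aG (i - 1); rewrite subrK; apply; apply: (itv_between Il Ir); lia.
rewrite diff3E !diff1_lift; apply: space_inj.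
  by rewrite planarD planarZ !planarB !planar_space -diff3E kG // scaleNr addNr.
rewrite heightD heightZ !heightB !height_space diff2_affine_distance a1 kG //.
by rewrite /affine_distance !det2E !mxE; ring.
Qed.

Lemma lift_equal_volume I G P :
  equal_area I G -> equal_volume I (lift_polygon G P).
Proof.
move=> aG i Il Ir; have [k nF] := lift_affine_normal P aG.
rewrite -(det3_affine_normal _ (k i)) nF // det3_vertical !diff1_lift !planar_space.
have := aG (i - 1); rewrite subrK; apply; apply: (itv_between Il Ir); lia.
Qed.

(** Once the affine normal is vertical and two consecutive edges are horizontal,
    the height of F' is the support function of the planar part with respect to
    the common vertex G(i0 - 1) of these edges: that support function vanishes
    on both edges, and its difference d to the height of F' solves the
    homogeneous recurrence d'' = - k d. *)
Lemma normal_frame_height I (F : int -> 'rV[R]_3) k i0 :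
  let G := @planar R \o F in
  i0 - 2 \in I -> i0 + 1 \in I ->
  equal_area I G -> affine_normal I F k (space 0 1) ->
  height (diff1 F (i0 - 1)) = 0 -> height (diff1 F i0) = 0 ->
  forall i, i - 1 \in I -> i \in I ->
    height (diff1 F i) = affine_distance G (G (i0 - 1)) i.
Proof.
move=> G I0l I0r aG nF h1 h0.
set P := G (i0 - 1); set z := affine_distance G P.
pose d i := height (diff1 F i) - z i.
have dE i : d i = 0 -> height (diff1 F i) = z i by exact: subr0_eq.
have det20 u : det2 (0 : 'rV[R]_2) u = 0 by rewrite det2E !mxE; ring.
have Q0 : d (i0 - 1) = 0 /\ d i0 = 0.
  split; first by rewrite /d h1 /z /affine_distance subrr det20 subrr.
  by rewrite /d h0 /z affine_distanceE subrr det20 subrr.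
have rec i : i - 2 \in I -> i + 1 \in I ->
    d (i + 1) - d i - (d i - d (i - 1)) = - k i * d i.
  move=> Il Ir.
  have E : diff3 F i = space 0 1 - k i *: diff1 F i by rewrite -(nF i) // addrK.
  have a1 : det2 (diff1 G (i - 1)) (diff1 G i) = 1.
    have := aG (i - 1); rewrite subrK; apply; apply: (itv_between Il Ir); lia.
  have G3 : diff3 G i = - k i *: diff1 G i.
    rewrite diff3_planar diff1_planar E planarB planarZ planar_space.
    by rewrite sub0r scaleNr.
  have H3 : height (diff1 F (i + 1)) - height (diff1 F i) -
      (height (diff1 F i) - height (diff1 F (i - 1))) =
      1 - k i * height (diff1 F i).
    by rewrite -!heightB -diff3E E heightB heightZ height_space.
  have := diff2_affine_distance G P i; rewrite /= -/z a1 G3 => Z.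
  have : det2 (G i - P) (- k i *: diff1 G i) = - k i * z i.
    by rewrite /z /affine_distance !det2E !mxE; ring.
  by move=> Z'; rewrite Z' in Z; rewrite /d; lra.
have Q i : i - 2 \in I -> i + 0 \in I -> d (i - 1) = 0 /\ d i = 0.
  apply: (@itv_window_ind I 2 0 (fun i => d (i - 1) = 0 /\ d i = 0) i0) => //.
    by apply: (itv_between I0l I0r); lia.
  move=> j jl _ _ jr; rewrite addr0 in jr; rewrite addrK.
  have Ej := rec j jl jr; split=> [] [e1 e2]; split=> //.
    by move: Ej; rewrite e1 e2; lra.
  by move: Ej; rewrite e1 e2; lra.
move=> i Il Ir; apply: dE.
have [le|lt] := leP i0 i.
  apply: (Q i _ _).2; last by rewrite addr0.
  by apply: (itv_between I0l Ir); lia.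
have := (Q (i + 1) _ _).1; rewrite addrK; apply.
  by rewrite (_ : i + 1 - 2 = i - 1) //; lia.
by rewrite addr0; apply: (itv_between Ir I0r); lia.
Qed.

End Lifts.

(** * Lifts are the polygons of constant mu *)

Theorem proposition4p1 (R : realType) (I : interval int) (I0 : 0 \in I) :
  (forall (G : int -> 'rV[R]_2) (P : 'rV[R]_2),
      equal_area I G ->
      equal_volume I (lift_polygon G P) /\ constant_mu I (lift_polygon G P)) /\
  (forall F : int -> 'rV[R]_3,
      (exists2 i : int, i - 2 \in I & i + 1 \in I) ->
      equal_volume I F -> constant_mu I F ->
      exists (G : int -> 'rV[R]_2) (P : 'rV[R]_2) (A : 'M[R]_3) (b : 'rV[R]_3),
        [/\ equal_area I G, \det A = 1
          & forall i : int, i \in I -> F i *m A + b = lift_polygon G P i]).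
Proof.
split=> [G P aG | F I4 vF cF].
  have vL := lift_equal_volume P aG; split=> //.
  have [k nL] := lift_affine_normal P aG.
  exact: constant_muP vL (affine_normal_is_mu nL) _.
have [k [e nF]] := constant_mu_affine_normal I4 cF.
have [i0 I0l I0r] := I4.
pose B : 'M[R]_3 := col_mx (diff1 F (i0 - 1)) (col_mx (diff1 F i0) e).
have detB : \det B = 1.
  by rewrite -(vF i0 I0l I0r) -(det3_affine_normal _ (k i0)) nF.
have uB : B \in unitmx by rewrite unitmxE detB unitr1.
pose A := invmx B.
have detA : \det A = 1 by rewrite det_inv detB invr1.
pose F1 i := F i *m A; pose G := @planar R \o F1.
have vF1 : equal_volume I F1 by apply: equal_volume_mul.
have [h1 h0 eA] : [/\ height (diff1 F1 (i0 - 1)) = 0, height (diff1 F1 i0) = 0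
    & e *m A = space 0 1].
  apply: standard_frame; rewrite !diff1_mul -(mulmxV uB) -/A.
  by rewrite /B !(mul_col_mx (m1 := 1)).
have nF1 : affine_normal I F1 k (space 0 1) by rewrite -eA; apply: affine_normal_mul.
have aG : equal_area I G.
  move=> i Il Ir; rewrite !diff1_planar -det3_vertical.
  exact: (det3_edges_normal I4 vF1 nF1).
pose P := G (i0 - 1).
have hF1 := normal_frame_height I0l I0r aG nF1 h1 h0.
exists G, P, A, (space 0 (- height (F1 0))); split=> // i Ii.
apply: space_inj; rewrite -/(F1 i) ?planarD ?heightD !(planar_space, height_space).
  by rewrite addr0.
pose Q i := height (F1 i) - height (F1 0) = isum (affine_distance G P) i.
apply: (@itv_window_ind I 0 0 Q 0); rewrite /Q ?subr0 ?addr0 ?subrr ?isum0 //.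
move=> j; rewrite !(subr0, addr0) => Ij _ Ij1 _.
have := hF1 (j + 1); rewrite addrK -[LHS]diff1_height => /(_ Ij Ij1).
by rewrite -(diff1_isum (affine_distance G P)) /diff1 addrK /= => Ej; split; lra.
Qed.
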